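(* Let $\tilde D$ be a $d\times d$ dilation matrix with associated standard multiresolution structure on $L^2(\mathbb{R}^d)$. For $\gamma\in\mathbb{Z}^d$ and any integer $n$, the translation $\pi^n_\gamma$ (when restricted to $X_n$) is a unitary element of $\mathcal{L}(X_n)$. The dilation $D$ is a unitary element of $\mathcal{L}(X_n,X_{n+1})$, and $\hat D$ is a unitary element of $\mathcal{L}(\hat X_n,\hat X_{n+1})$. Hence the Hilbert $C^*(\mathbb{Z}^d)$-modules $(X_n)_{n\in\mathbb{Z}}$ are all isomorphic (as Hilbert $C^*(\mathbb{Z}^d)$-modules) to each other, and the Hilbert $C(\mathbb{T}^d)$-modules $(\hat X_n)_{n\in\mathbb{Z}}$ are also isomorphic to each other.
   Context: Conventions. $\mathbb{T}^d=\mathbb{R}^d/\mathbb{Z}^d$; $\widehat{\mathbb{R}^d}$ is identified with $\mathbb{R}^d$ through $(x,\xi)=e^{2\pi i x\cdot\xi}$; $(\gamma,\zeta)=e^{2\pi i\gamma\cdot\zeta}$ for $\gamma\in\mathbb{Z}^d,\zeta\in\mathbb{T}^d$. The Fourier transform $\mathcal{F}$ on $\mathbb{R}^d$ is $\hat f(\xi)=\int f(x)(x,\xi)\,dx$ (extended to $L^2$), and on $\mathbb{Z}^d$ it is $\hat a(\zeta)=\sum_\gamma a(\gamma)(\gamma,\zeta)$; the latter extends to the identification $C^*(\mathbb{Z}^d)\cong C(\mathbb{T}^d)$, through which elements of $C^*(\mathbb{Z}^d)$ are also regarded as functions on $\mathbb{Z}^d$ (Fourier coefficients). Dilation. A dilation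 matrix is an integer $d\times d$ matrix $\tilde D$ all of whose eigenvalues are greater than $1$ in absolute value; $m=|\det\tilde D|$. The standard multiresolution structure has translation group $\mathbb{Z}^d$ acting on $L^2(\mathbb{R}^d)$ by translation and dilation $(Df)(x)=\sqrt m\,f(\tilde Dx)$. Also $\hat D=\mathcal{F}D\mathcal{F}^*$, i.e. $(\hat Dp)(\xi)=\frac{1}{\sqrt m}p((\tilde D^* )^{-1}\xi)$. For $\gamma\in\mathbb{Z}^d$, $(\pi^n_\gamma f)(x)=f(x-\tilde D^{-n}\gamma)$. Operations. $\hat\iota_n(\xi)=\hat\iota(\tilde D^{*-n}\xi)$, where $\hat\iota:\widehat{\mathbb{R}^d}\to\mathbb{T}^d$ is the quotient map. Define $[f,g]_n(\gamma)=\int_{\mathbb{R}^d}\overline{f(x-\tilde D^{-n}\gamma)}g(x)\,dx$, $(f\circ_n a)(x)=\sum_{\gamma\in\mathbb{Z}^d}a(\gamma)f(x-\tilde D^{-n}\gamma)$, $[\![p,q]\!]_n(\zeta)=m^n\sum_{\hat\iota_n(\xi)=\zeta}\overline{p(\xi)}q(\xi)$, $(p\,\widehat{\circ_n}\,b)(\xi)=p(\xi)b(\hat\iota_n(\xi))$. Modules. For $f\in C_c(\mathbb{R}^d)$, $\|f\|_{X_n}=\sup_{\zeta\in\mathbb{T}^d}\sqrt{\widehat{[f,f]_n}(\zeta)}$. $X_n$ is the completion of $C_c(\mathbb{R}^d)$ in this norm, regarded as a subspace of $L^2(\mathbb{R}^d)$ via the continuous extension of the inclusion (one has $\|f\|_2\le\|f\|_{X_n}$);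 it is a Hilbert $C^*(\mathbb{Z}^d)$-module with $[\cdot,\cdot]_n$ and $\circ_n$ extended by continuity. $\hat X_n$ is its image under $\mathcal{F}$, a Hilbert $C(\mathbb{T}^d)$-module with $[\![\cdot,\cdot]\!]_n$ and $\widehat{\circ_n}$. Adjointable operators. For Hilbert modules $E,F$ over the same $C^*$-algebra, $\mathcal{L}(E,F)$ is the set of maps $t:E\to F$ for which there is $t^*:F\to E$ with $[tx,y]=[x,t^*y]$ for all $x\in E,y\in F$; $\mathcal{L}(E)=\mathcal{L}(E,E)$. An element $u\in\mathcal{L}(E,F)$ is unitary if $u^*u=\mathrm{Id}$ and $uu^*=\mathrm{Id}$, and $E,F$ are isomorphic if such a $u$ exists. *)

(* Defs.v *)
From HB Require Import structures.
From mathcomp Require Import all_boot all_order all_algebra.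
From mathcomp Require Import complex.
From mathcomp Require Import all_classical all_reals all_analysis.
From mathcomp Require Import showcase.summability.

Set Implicit Arguments.
Unset Strict Implicit.
Unset Printing Implicit Defensive.

Import Order.TTheory GRing.Theory Num.Theory.
Import numFieldNormedType.Exports.

Local Open Scope classical_set_scope.
Local Open Scope ring_scope.
Local Open Scope complex_scope.

(* The regular-module alias [R[i]^o] is the one carrying the topology of the
   complex numbers.  [complex.Re], [complex.Im] are used throughout, and
   [cabs] is the modulus as an element of [R] (the norm of [R[i]] takes its
   values in [R[i]]). *)
Notation Cplx R := (R[i]^o).

Definition cabs (R : realType) (z : Cplx R) : R := complex.Re `|z|.

Definition cexp (R : realType) (t : R) : Cplx R :=
  cos (2 * pi * t) +i* sin (2 * pi * t).

Definition dot (R : realType) d (x y : 'cV[R]_d) : R :=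
  \sum_(i < d) x i 0 * y i 0.

Definition intv (R : realType) d (k : 'cV[int]_d) : 'cV[R]_d := map_mx intr k.
Arguments intv R {d} k.

Definition measure_col_display : measure_display -> measure_display.
Proof. exact. Qed.

Section measurable_col.
Context {d0} {T : sigmaRingType d0}.
Variable n : nat.

Let coors : 'I_n -> 'cV[T]_n -> T := fun i x => x i 0.

Let col_set0 : g_sigma_preimage coors set0.
Proof. exact: sigma_algebra0. Qed.

Let col_setC A : g_sigma_preimage coors A -> g_sigma_preimage coors (~` A).
Proof. exact: sigma_algebraC. Qed.

Let col_bigcup (F : _^nat) : (forall i, g_sigma_preimage coors (F i)) ->
  g_sigma_preimage coors (\bigcup_i (F i)).
Proof. exact: sigma_algebra_bigcup. Qed.

(* The product sigma-algebra: for real entries, the Borel sets. *)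
HB.instance Definition _ := @isMeasurable.Build (measure_col_display d0)
  'cV[T]_n (g_sigma_preimage coors) col_set0 col_setC col_bigcup.

End measurable_col.

Section lebesgue.
Variable R : realType.

Definition consv d (xy : measurableTypeR R * 'cV[R]_d) : 'cV[R]_d.+1 :=
  \col_i (if unlift ord0 i is Some j then xy.2 j 0 else xy.1).

Lemma measurable_consv d : measurable_fun [set: _] (@consv d).
Proof.
apply: (@measurability _ _ _ _ [set: _] (@consv d) (\big[setU/set0]_(i < d.+1)
  preimage_set_system setT (fun x : 'cV[R]_d.+1 => x i 0) measurable)) => //.
move=> _ [A + <-]; rewrite -bigcup_mkord_ord => -[i /= id1 [B mB <-]].
rewrite !setTI.
have := unliftP ord0 (inord i : 'I_d.+1); case=> [j ij|i0].
- have -> : @consv d @^-1` ((fun x => x (inord i) 0) @^-1` B) =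
      (fun xy : measurableTypeR R * 'cV[R]_d => xy.2 j 0) @^-1` B.
    by apply/seteqP; split=> -[x y] /=; rewrite mxE ij liftK.
  rewrite -[X in measurable X]setTI.
  have mj : measurable_fun [set: 'cV[R]_d] (fun y : 'cV[R]_d => y j 0).
    move=> _ Y mY; rewrite setTI; apply: sub_sigma_algebra => /=.
    rewrite -bigcup_seq/=; exists j => /=; first by rewrite mem_index_enum.
    by exists Y => //; rewrite setTI.
  exact: (measurableT_comp mj measurable_snd).
- have -> : @consv d @^-1` ((fun x => x (inord i) 0) @^-1` B) =
      (fun xy : measurableTypeR R * 'cV[R]_d => xy.1) @^-1` B.
    by apply/seteqP; split=> -[x y] /=; rewrite mxE i0 unlift_none.
  by rewrite -[X in measurable X]setTI; exact: measurable_fst.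
Qed.

Definition leb_succ d (mu : {measure set 'cV[R]_d -> \bar R}) :=
  pushforward (@lebesgue_measure R \x^ mu)%E (@consv d).

Section leb_succ_measure.
Variables (d : nat) (mu : {measure set 'cV[R]_d -> \bar R}).
Let mf := @measurable_consv d.

Let leb_succ0 : leb_succ mu set0 = 0%E. Proof. exact: measure0. Qed.

Let leb_succ_ge0 A : (0 <= leb_succ mu A)%E. Proof. exact: measure_ge0. Qed.

Let leb_succ_sigma_additive : semi_sigma_additive (leb_succ mu).
Proof. exact: measure_semi_sigma_additive. Qed.

HB.instance Definition _ := isMeasure.Build _ _ _ (leb_succ mu)
  leb_succ0 leb_succ_ge0 leb_succ_sigma_additive.

End leb_succ_measure.

Fixpoint lebesgue d : {measure set 'cV[R]_d -> \bar R} :=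
  match d with
  | 0 => @dirac _ 'cV[R]_0 0 R
  | d'.+1 => leb_succ (lebesgue d')
  end.

End lebesgue.

Section lebesgue_box.
Variable R : realType.

Lemma measurable_box d (a b : 'cV[R]_d) :
  measurable [set x : 'cV[R]_d | forall i, x i 0 \in `[a i 0, b i 0]].
Proof.
have -> : [set x : 'cV[R]_d | forall i, x i 0 \in `[a i 0, b i 0]] =
    \big[setI/setT]_(i < d) ((fun x : 'cV[R]_d => x i 0) @^-1` `[a i 0, b i 0]).
  apply/seteqP; split=> x /=.
    by move=> H; rewrite -bigcap_seq => i _ /=; exact: H.
  rewrite -bigcap_seq => H i; apply: (H i) => /=.
  by rewrite mem_index_enum.
apply: bigsetI_measurable => i _.
apply: sub_sigma_algebra => /=.
rewrite -bigcup_seq/=; exists i => /=; first by rewrite mem_index_enum.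
exists [set` `[a i 0, b i 0]]; last by rewrite setTI.
exact: measurable_itv.
Qed.

Lemma lebesgue_box d (a b : 'cV[R]_d) : (forall i, a i 0 <= b i 0) ->
  lebesgue R d [set x : 'cV[R]_d | forall i, x i 0 \in `[a i 0, b i 0]] =
  (\prod_(i < d) (b i 0 - a i 0))%:E.
Proof.
elim: d a b => [|d IH] a b ab /=.
  by rewrite big_ord0 diracE mem_set//= => -[].
rewrite /leb_succ /pushforward.
pose a' : 'cV[R]_d := \col_i a (lift ord0 i) 0.
pose b' : 'cV[R]_d := \col_i b (lift ord0 i) 0.
have -> : @consv R d @^-1` [set x | forall i, x i 0 \in `[a i 0, b i 0]] =
    ([set` `[a ord0 0, b ord0 0]] : set (measurableTypeR R)) `*`
    [set x : 'cV[R]_d | forall i, x i 0 \in `[a' i 0, b' i 0]].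
  apply/seteqP; split=> -[x y] /=.
    move=> H; split.
      by have := H ord0; rewrite mxE unlift_none.
    by move=> i; have := H (lift ord0 i); rewrite !mxE liftK.
  move=> [Hx Hy] i; rewrite mxE; case: unliftP => [j ->|->//].
  by have := Hy j; rewrite !mxE.
rewrite product_measure2E//; [|exact: measurable_box].
rewrite IH; last by move=> i; rewrite !mxE; exact: ab.
rewrite [X in (X * _)%E](lebesgue_measure_itv `[a ord0 0, b ord0 0])/=.
rewrite lte_fin big_ord_recl.
have -> : (\prod_(i < d) (b' i 0 - a' i 0)) =
  \prod_(i < d) (b (lift ord0 i) 0 - a (lift ord0 i) 0).
  by apply: eq_bigr => i _; rewrite !mxE.
rewrite EFinM; congr (_ * _)%E; case: ifPn => [_|]; first by rewrite EFinB.
rewrite -leNgt => ba; have -> : a ord0 0 = b ord0 0.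
  by apply/eqP; rewrite eq_le ba ab.
by rewrite subrr.
Qed.

End lebesgue_box.

Section torus.
Variables (R : realType) (d : nat).

Definition lattice_eq (x y : 'cV[R]_d) : bool :=
  `[< exists k : 'cV[int]_d, x - y = intv R k >].

Let lattice_eq_refl : reflexive lattice_eq.
Proof.
by move=> x; apply/asboolP; exists 0; rewrite subrr /intv map_mx0.
Qed.

Let lattice_eq_sym : symmetric lattice_eq.
Proof.
have imp x y : lattice_eq x y -> lattice_eq y x.
  move=> /asboolP[k kE]; apply/asboolP; exists (- k).
  by rewrite -opprB kE /intv map_mxN.
by move=> x y; apply/idP/idP; exact: imp.
Qed.

Let lattice_eq_trans : transitive lattice_eq.
Proof.
move=> y x z /asboolP[k kE] /asboolP[l lE]; apply/asboolP; exists (k + l).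
by rewrite /intv map_mxD -[map_mx _ k]kE -[map_mx _ l]lE addrA subrK.
Qed.

Definition lattice_equiv :=
  EquivRel lattice_eq lattice_eq_refl lattice_eq_sym lattice_eq_trans.

Local Open Scope quotient_scope.

Definition torus := {eq_quot lattice_equiv}.
HB.instance Definition _ := Topological.copy torus (quotient_topology torus).
HB.instance Definition _ := Quotient.on torus.

Definition tproj (x : 'cV[R]_d) : torus := \pi_torus x.

Record ctorus := CTorus {
  cfun :> torus -> Cplx R;
  _ : continuous cfun }.

HB.instance Definition _ := gen_eqMixin ctorus.
HB.instance Definition _ := gen_choiceMixin ctorus.
HB.instance Definition _ :=
  isPointed.Build ctorus (CTorus (fun x => @cst_continuous _ _ (0 : Cplx R) x)).

Definition cint (A : set 'cV[R]_d) (f : 'cV[R]_d -> Cplx R) : Cplx R :=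
  Rintegral (lebesgue R d) A (fun x => complex.Re (f x)) +i*
  Rintegral (lebesgue R d) A (fun x => complex.Im (f x)).

Definition unit_cube : set 'cV[R]_d := [set x | forall i, x i 0 \in `[0, 1]].

(* The sign makes this inverse to [fourierZ]. *)
Definition fourier_coef (phi : ctorus) (g : 'cV[int]_d) : Cplx R :=
  cint unit_cube (fun x => phi (tproj x) * cexp (- dot (intv R g) x)).

(* C^*(Z^d), whose elements are regarded as functions on Z^d through
   C^*(Z^d) = C(T^d). *)
Record cstarZ := CStarZ {
  coef :> 'cV[int]_d -> Cplx R;
  _ : exists phi : ctorus, coef = fourier_coef phi }.

HB.instance Definition _ := gen_eqMixin cstarZ.
HB.instance Definition _ := gen_choiceMixin cstarZ.
HB.instance Definition _ :=
  isPointed.Build cstarZ (CStarZ (ex_intro _ point erefl)).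

(* For finitely supported [a]; the value does not depend on the
   representative of [z]. *)
Definition fourierZ (a : 'cV[int]_d -> Cplx R) (z : torus) : Cplx R :=
  \sum_(g \in [set: 'cV[int]_d]) a g * cexp (dot (intv R g) (repr z)).

(* Convergence in C^*(Z^d) of finitely supported functions: the C^*-norm is
   the supremum norm of the Fourier transform. *)
Definition cvg_cstarZ (u : nat -> 'cV[int]_d -> Cplx R) (a : cstarZ) : Prop :=
  exists2 phi : ctorus, coef a = fourier_coef phi &
    forall e : R, 0 < e -> \forall k \near \oo,
      forall z : torus, cabs (fourierZ (u k) z - phi z) < e.

End torus.

Section L2.
Variables (R : realType) (d : nat).
Implicit Types f g : 'cV[R]_d -> Cplx R.

Definition ae_rel f g : bool := `[< f = g %[ae lebesgue R d] >].

Let ae_rel_refl : reflexive ae_rel.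
Proof. by move=> f; apply/asboolP; exact: ae_eq_refl. Qed.

Let ae_rel_sym : symmetric ae_rel.
Proof.
by move=> f g; apply/idP/idP => /asboolP h; apply/asboolP/ae_eq_sym.
Qed.

Let ae_rel_trans : transitive ae_rel.
Proof.
by move=> g f h /asboolP fg /asboolP gh; apply/asboolP/(ae_eq_trans fg gh).
Qed.

Definition ae_equiv := EquivRel ae_rel ae_rel_refl ae_rel_sym ae_rel_trans.

Local Open Scope quotient_scope.

(* All functions modulo equality almost everywhere, measurable or not: this
   lets operators be defined on every class.  L^2(R^d) is the subset [L2] of
   the classes having a square-integrable representative, and [cvg_L2] below
   forces its limit to lie in it. *)
Definition aefun := {eq_quot ae_equiv}.
HB.instance Definition _ := Choice.on aefun.
HB.instance Definition _ := EqQuotient.on aefun.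

Definition aeclass f : aefun := \pi_aefun f.

Definition cmeasurable f : Prop :=
  measurable_fun setT (fun x => complex.Re (f x)) /\
  measurable_fun setT (fun x => complex.Im (f x)).

Definition square_integrable f : Prop :=
  cmeasurable f /\ (\int[lebesgue R d]_x ((cabs (f x)) ^+ 2)%:E < +oo)%E.

Definition absolutely_integrable f : Prop :=
  cmeasurable f /\ (\int[lebesgue R d]_x (cabs (f x))%:E < +oo)%E.

Definition L2 : set aefun :=
  [set x | exists2 f, square_integrable f & x = aeclass f].

Definition cvg_L2 (f : nat -> 'cV[R]_d -> Cplx R) (x : aefun) : Prop :=
  exists g, [/\ square_integrable g, x = aeclass g &
    (fun k => \int[lebesgue R d]_x ((cabs (f k x - g x)) ^+ 2)%:E)%E @ \oo
      --> 0%E].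

Definition Cc : set ('cV[R]_d -> Cplx R) :=
  [set f | continuous f /\
    exists2 K : set 'cV[R]_d, compact K & forall x, ~ K x -> f x = 0].

Definition fourier f (xi : 'cV[R]_d) : Cplx R :=
  cint setT (fun x => f x * cexp (dot x xi)).

(* The graph of the extension to L^2 of the Fourier transform, initially
   defined on the intersection of L^1 and L^2. *)
Definition is_fourier (x p : aefun) : Prop :=
  exists f : nat -> 'cV[R]_d -> Cplx R,
    [/\ forall k, absolutely_integrable (f k) /\ square_integrable (f k),
        cvg_L2 f x & cvg_L2 (fun k => fourier (f k)) p].

End L2.
Arguments aeclass {R d} f.

(* The data of a Hilbert module over [A], carried by a subset of an ambient
   space [V]; the inner product and the action are only meaningful on the
   carrier.  The axioms are not part of the record: adjointability and
   unitarity refer to the inner products only, and between Hilbert modules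
   an adjointable map is automatically linear and [A]-linear. *)
Record hmodule (V A : Type) := HModule {
  carrier : set V;
  inner : V -> V -> A;
  act : V -> A -> V }.

Section adjointable.
Variables (V W A : Type).
Implicit Types (E : hmodule V A) (F : hmodule W A) (t : V -> W) (s : W -> V).

Definition is_adjoint E F t s : Prop :=
  [/\ forall x, carrier E x -> carrier F (t x),
      forall y, carrier F y -> carrier E (s y) &
      forall x y, carrier E x -> carrier F y ->
        inner F (t x) y = inner E x (s y)].

Definition adjointable E F t : Prop := exists s, is_adjoint E F t s.

Definition unitary E F t : Prop :=
  exists s, [/\ is_adjoint E F t s,
    forall x, carrier E x -> s (t x) = x &
    forall y, carrier F y -> t (s y) = y].

Definition isomorphic E F : Prop := exists t, unitary E F t.

End adjointable.

Section dilation.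
Variables (R : realType) (d : nat) (D : 'M[int]_d.+1).
Local Notation V := 'cV[R]_d.+1.
Local Notation C := (Cplx R).
Local Notation fct := (V -> C).
Local Notation Z := 'cV[int]_d.+1.
Local Open Scope quotient_scope.

Definition dilation_matrix : Prop :=
  forall l : R[i], eigenvalue (map_mx intr D : 'M[R[i]]_d.+1) l -> 1 < `|l|.

Definition Dmx : 'M[R]_d.+1 := map_mx intr D.

Definition absdet : R := `|\det D|%:~R.

Definition shift (n : int) (g : Z) : V := Dmx ^ (- n) *m intv R g.

Definition transl_fun n (g : Z) (f : fct) : fct := fun x => f (x - shift n g).

Definition transl n (g : Z) (x : aefun R d.+1) : aefun R d.+1 :=
  aeclass (transl_fun n g (repr x)).

Definition dil (x : aefun R d.+1) : aefun R d.+1 :=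
  aeclass (fun t => (Num.sqrt absdet)%:C * repr x (Dmx *m t)).

(* F D F^* for the Fourier transform F on L^2, written out: the factor is
   sqrt m / m, where 1 / m is the Jacobian of the substitution. *)
Definition dil_hat (p : aefun R d.+1) : aefun R d.+1 :=
  aeclass (fun xi => ((Num.sqrt absdet)^-1)%:C * repr p (Dmx^T^-1 *m xi)).

Definition bracket n (f g : fct) (h : Z) : C :=
  cint setT (fun x => (transl_fun n h f x)^* * g x).

(* for finitely supported [a] *)
Definition circ n (f : fct) (a : Z -> C) : fct := fun x =>
  \sum_(h \in [set: Z]) a h * transl_fun n h f x.

(* For [f] in C_c(R^d) the transform of [bracket n f f] is real and
   nonnegative. *)
Definition Xnorm n (f : fct) : R :=
  sup [set Num.sqrt (complex.Re (fourierZ (bracket n f f) z))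
      | z in [set: torus R d.+1]].

(* [f] represents [x] in the completion of C_c(R^d) for [Xnorm n], seen
   in L^2(R^d) *)
Definition approx n (f : nat -> fct) (x : aefun R d.+1) : Prop :=
  [/\ forall k, Cc (f k),
      forall e : R, 0 < e -> \forall N \near \oo,
        forall i j, (N <= i)%N -> (N <= j)%N ->
          Xnorm n (fun t => f i t - f j t) < e &
      cvg_L2 f x].

(* The inner product and the action are extended by continuity from
   C_c(R^d) and finitely supported functions on Z^d. *)
Definition Xinner n (x y : aefun R d.+1) : cstarZ R d.+1 :=
  get [set a | exists f g, [/\ approx n f x, approx n g y &
    cvg_cstarZ (fun k => bracket n (f k) (g k)) a]].

Definition Xact n (x : aefun R d.+1) (a : cstarZ R d.+1) : aefun R d.+1 :=
  xget (aeclass (fun=> 0)) [set y | exists f u, [/\ approx n f x,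
    forall k, finite_set [set h | u k h != 0],
    cvg_cstarZ u a & approx n (fun k => circ n (f k) (u k)) y]].

Definition Xmod n : hmodule (aefun R d.+1) (cstarZ R d.+1) := {|
  carrier := [set x | exists f, approx n f x];
  inner := Xinner n;
  act := Xact n |}.

Definition iota_hat n (xi : V) : torus R d.+1 :=
  tproj (Dmx^T ^ (- n) *m xi).

(* The sum over the fibre of [iota_hat n] converges unconditionally above
   almost every point of the torus, and for [p], [q] in the carrier of
   [Xhatmod n] it agrees almost everywhere with a unique continuous function.
   A property holds almost everywhere on the torus when its pullback to R^d
   does. *)
Definition Xhat_inner n (p q : aefun R d.+1) : ctorus R d.+1 :=
  get [set phi : ctorus R d.+1 | \forall t \ae lebesgue R d.+1,
    (fun F => (absdet ^ n)%:C * partial_sum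
      (patch (fun=> 0) [set xi | iota_hat n xi = tproj t]
         (fun xi => (repr p xi)^* * repr q xi : C)) F) @ totally
      --> phi (tproj t)].

Definition Xhat_act n (p : aefun R d.+1) (b : ctorus R d.+1) : aefun R d.+1 :=
  aeclass (fun xi => repr p xi * b (iota_hat n xi)).

Definition Xhatmod n : hmodule (aefun R d.+1) (ctorus R d.+1) := {|
  carrier := [set p | exists2 x, carrier (Xmod n) x & is_fourier x p];
  inner := Xhat_inner n;
  act := Xhat_act n |}.

End dilation.

(* Main.v *)
(* Translations, the dilation and its Fourier transform are all operators
   W f (x) = sqrt |det A| f (A x + b), up to equality almost everywhere, with A
   invertible.  The change of variables formula gives
   <W f, W g> = <f, g>, and W carries translations by D^-n g to translations by
   D^-m g when A D^-m = D^-n, so that W transports [f, g]_n into [W f, W g]_m;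
   the norms, the completions and the extended inner products follow.
   Conjugated by the Fourier transform, W becomes the operator of the inverse
   transpose of A, and on the Fourier side the sums over the fibres are
   reindexed by it. *)
From HB Require Import structures.
From mathcomp Require Import all_boot all_order all_algebra.
From mathcomp Require Import complex finmap.
From mathcomp Require Import all_classical all_reals all_analysis.
From mathcomp Require Import measurable_realfun.
From mathcomp Require Import showcase.summability.
Require Import Defs.

Set Implicit Arguments.
Unset Strict Implicit.
Unset Printing Implicit Defensive.

Import Order.TTheory GRing.Theory Num.Theory.
Import numFieldNormedType.Exports.

Local Open Scope classical_set_scope.
Local Open Scope ring_scope.

(** * Maps that multiply a measure by a constant, and change of variables *)

Definition scales {disp} {T : measurableType disp} {R : realType}
    (mu : set T -> \bar R) (phi : T -> T) (r : R) :=
  measurable_fun setT phi /\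
  forall A, measurable A -> mu (phi @^-1` A) = (r%:E * mu A)%E.

Section scales.
Context {disp} {T : measurableType disp} {R : realType}.
Variable mu : {measure set T -> \bar R}.
Implicit Types (phi psi : T -> T) (r s c : R).
Local Notation scales := (scales mu).

Lemma scales_comp phi psi r s :
  scales phi r -> scales psi s -> scales (phi \o psi) (r * s).
Proof.
move=> [mphi phir] [mpsi psis]; split=> [|A mA]; first exact: measurableT_comp.
rewrite comp_preimage psis ?phir ?muleA ?EFinM 1?[X in (X * _)%E]muleC//.
by rewrite -[X in measurable X]setTI; exact: mphi.
Qed.

Lemma scales_inv phi psi r :
  r != 0 -> cancel phi psi -> measurable_fun setT psi ->
  scales phi r -> scales psi r^-1.
Proof.
move=> r0 phiK mpsi [mphi phir]; split=> // A mA.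
have mpA : measurable (psi @^-1` A).
  by rewrite -[X in measurable X]setTI; exact: mpsi.
have phipsi : phi @^-1` (psi @^-1` A) = A.
  by apply/seteqP; split=> x /=; rewrite phiK.
by rewrite -[in RHS]phipsi phir// muleA -EFinM mulVf// mul1e.
Qed.

Lemma negligible_scales phi r N :
  scales phi r -> mu.-negligible N -> mu.-negligible (phi @^-1` N).
Proof.
move=> [mphi phir] [A [mA A0 NA]]; exists (phi @^-1` A); split.
- by rewrite -[X in measurable X]setTI; exact: mphi.
- by rewrite phir// A0 mule0.
- exact: preimage_subset.
Qed.

(** The image of [mu] under [phi] is [r] times [mu], so this is integration against an image
    measure. *)
Lemma ge0_measurable_integral_scales phi r (f : T -> \bar R) : 0 <= r ->
  scales phi r -> measurable_fun setT f -> (forall x, 0 <= f x)%E ->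
  (\int[mu]_x f (phi x) = r%:E * \int[mu]_x f x)%E.
Proof.
move=> r0 [mphi phir] mf f0.
rewrite -(@ge0_integral_mscale _ _ _ mu _ measurableT (NngNum r0))//.
rewrite -(@ge0_integral_pushforward _ _ _ _ _ _ mphi mu setT f)//.
by apply: eq_measure_integral => A mA _; exact: phir.
Qed.

Import HBNNSimple.

(** Monotonicity for possibly nonmeasurable functions, straight from the integral as a supremum over
    simple functions. Representatives of a class in [aefun] may be nonmeasurable. *)
Let ge0_le_integralT (f g : T -> \bar R) : (forall x, 0 <= f x)%E ->
  (forall x, f x <= g x)%E -> (\int[mu]_x f x <= \int[mu]_x g x)%E.
Proof.
move=> f0 fg; rewrite !ge0_integralTE// => [|x]; last exact: le_trans (fg x).
by apply: le_ereal_sup => _ [h hf <-]; exists h => // x; exact: le_trans (fg x).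
Qed.

(** A simple function [h] below [f] yields the measurable function [c * h (phi x)] below the
    integrand on the right. *)
Let ge0_integral_scales_ge phi r c (f : T -> \bar R) : 0 <= r -> 0 <= c ->
  scales phi r -> (forall x, 0 <= f x)%E ->
  ((c * r)%:E * \int[mu]_x f x <= \int[mu]_x (c%:E * f (phi x)))%E.
Proof.
move=> r0 c0 sphi f0.
have [->|cr0] := eqVneq (c * r) 0.
  by rewrite mul0e integral_ge0// => x _; rewrite mule_ge0.
have {}cr0 : 0 < c * r by rewrite lt0r cr0 mulr_ge0.
rewrite muleC -lee_pdivlMr// ge0_integralTE//.
apply: ge_ereal_sup => _ [h /= hf <-].
rewrite lee_pdivlMr// muleC.
have -> : sintegral mu h = (\int[mu]_x (h x)%:E)%E.
  by rewrite integral_nnsfun// patch_setT.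
have mh : measurable_fun setT (EFin \o h) by exact/measurable_EFinP.
rewrite EFinM -muleA -(@ge0_measurable_integral_scales phi r (EFin \o h))//.
  rewrite -ge0_integralZl_EFin//.
  - apply: ge0_le_integralT => x; first by rewrite mule_ge0//= lee_fin.
    by rewrite lee_pmul//= lee_fin.
  - by move=> x _ /=; rewrite lee_fin.
  - by apply/measurable_EFinP; apply: measurableT_comp => //; case: sphi.
by move=> x /=; rewrite lee_fin.
Qed.

(* The integral of an arbitrary [f] is a supremum over the simple functions
   below [f], and [phi] transports these. *)
Lemma ge0_integral_scales phi psi r c (f : T -> \bar R) :
  cancel phi psi -> cancel psi phi -> measurable_fun setT psi ->
  0 < r -> 0 < c -> scales phi r -> (forall x, 0 <= f x)%E ->
  (\int[mu]_x (c%:E * f (phi x)) = (c * r)%:E * \int[mu]_x f x)%E.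
Proof.
move=> phiK psiK mpsi r0 c0 sphi f0; apply/eqP; rewrite eq_le.
apply/andP; split; last exact: ge0_integral_scales_ge (ltW _) (ltW _) _ _.
have spsi : scales psi r^-1 by apply: scales_inv sphi => //; rewrite gt_eqF.
have cf0 x : (0 <= c%:E * f (phi x))%E by rewrite mule_ge0// lee_fin ltW.
(* The upper estimate is the lower one for the inverse map [psi], with inverse constants, applied to
   the transported integrand. *)
have := @ge0_integral_scales_ge psi r^-1 c^-1 (fun x => c%:E * f (phi x))%E.
rewrite !invr_ge0 => /(_ (ltW r0) (ltW c0) spsi cf0).
under [X in (_ <= X)%E -> _]eq_integral.
  by move=> x _; rewrite psiK muleA -EFinM mulVf ?gt_eqF// mul1e; over.
rewrite -invfM muleC -lee_pdivlMr ?invr_gt0 ?mulr_gt0// invrK.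
by rewrite muleC.
Qed.

Lemma Rintegral_scales phi psi r c (f : T -> R) :
  cancel phi psi -> cancel psi phi -> measurable_fun setT psi ->
  0 < r -> 0 < c -> scales phi r ->
  Rintegral mu setT (fun x => c * f (phi x)) = c * r * Rintegral mu setT f.
Proof.
move=> phiK psiK mpsi r0 c0 sphi; rewrite /Rintegral.
rewrite integralE [in RHS]integralE.
have cr0 : 0 < c * r by rewrite mulr_gt0.
rewrite (_ : \int[mu]_x _ = (c * r)%:E * \int[mu]_x (EFin \o f)^\+ x)%E.
  rewrite (_ : \int[mu]_x (fun x => (c * f (phi x))%:E)^\- x =
      (c * r)%:E * \int[mu]_x (EFin \o f)^\- x)%E.
    set a := integral _ _ _; set b := integral _ _ _.
    have [a0 b0] : (0 <= a /\ 0 <= b)%E by split; exact: integral_ge0.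
    (* The parts may have infinite integrals. Multiplication by the positive [c * r] keeps
       infinities, and [fine] then sends both sides to 0. *)
    move: a b a0 b0 => [a| |] [b| |] //= _ _;
      by rewrite ?gt0_muley ?gt0_muleNy ?lte_fin ?mulr0//= mulrBr.
  rewrite -(ge0_integral_scales phiK)//; apply: eq_integral => x _.
  rewrite !funenegE /= -mulrN EFinM -[X in maxe _ X](mule0 c%:E).
  by rewrite maxe_pMr// lee_fin ltW.
rewrite -(ge0_integral_scales phiK)//; apply: eq_integral => x _.
rewrite !funeposE /= EFinM -[X in maxe _ X](mule0 c%:E).
by rewrite maxe_pMr// lee_fin ltW.
Qed.

End scales.

(** * Affine changes of variables for Lebesgue measure *)

Section lebesgue_affine.
Variable R : realType.
Local Notation lambda := (@lebesgue_measure R).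

Lemma measurable_coord d (i : 'I_d) :
  measurable_fun setT (fun x : 'cV[R]_d => x i 0).
Proof.
move=> _ Y mY; rewrite setTI; apply: sub_sigma_algebra => /=.
rewrite -bigcup_seq/=; exists i => /=; first by rewrite mem_index_enum.
by exists Y => //; rewrite setTI.
Qed.

Lemma measurable_fun_col disp (T : measurableType disp) d (f : T -> 'cV[R]_d) :
  (forall i, measurable_fun setT (fun t => f t i 0)) -> measurable_fun setT f.
Proof.
move=> mf; apply: (@measurability _ _ _ _ setT f (\big[setU/set0]_(i < d)
  preimage_set_system setT (fun x : 'cV[R]_d => x i 0) measurable)) => //.
move=> _ [A + <-]; rewrite -bigcup_seq => -[i /= _ [B mB <-]].
by rewrite !setTI -[X in measurable X]setTI; exact: mf.
Qed.

Lemma measurable_affine d e (A : 'M[R]_(e, d)) (b : 'cV[R]_e) :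
  measurable_fun setT (fun x : 'cV[R]_d => A *m x + b).
Proof.
apply: measurable_fun_col => i.
under eq_fun do rewrite mxE mxE.
apply: measurable_funD => //; apply: measurable_sum => j.
by apply: measurable_funM => //; exact: measurable_coord.
Qed.

Lemma sigma_finite_lebesgue d : sigma_finite setT (lebesgue R d).
Proof.
pose a n : 'cV[R]_d := const_mx (- n%:R).
pose b n : 'cV[R]_d := const_mx n%:R.
exists (fun n => [set x : 'cV[R]_d | forall i, x i 0 \in `[a n i 0, b n i 0]]).
  apply/esym; rewrite -subTset => x _.
  pose M := \sum_i `|x i 0|.
  exists (Num.truncn M).+1 => // i; rewrite !mxE in_itv/= -ler_norml.
  apply: le_trans (ltW (truncnS_gt M)).
  by rewrite /M (bigD1 i)//= lerDl sumr_ge0.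
move=> n; split; first exact: measurable_box.
rewrite lebesgue_box ?ltry// => i; rewrite !mxE.
by rewrite (@le_trans _ _ 0)// oppr_le0.
Qed.

(** For [a > 0], the measure [a] times the image of [lambda] agrees with [lambda] on half-open
    intervals, hence everywhere by uniqueness. Reflection invariance reduces negative [a] to this
    case. *)
Lemma scales_lebesgue_measure (a b : R) : a != 0 ->
  scales lambda (fun x => a * x + b) `|a|^-1.
Proof.
wlog a0 : a b / 0 < a => [wlg a0|_].
  case: (ltgtP a 0) (a0) => // [an0 _|an0 _]; last exact: wlg.
  have -> : (fun x => a * x + b) = (fun x => - a * x + b) \o -%R.
    by apply/funext => x /=; rewrite mulrNN.
  rewrite -normrN -[_^-1]mulr1; apply: scales_comp.
    by apply: wlg; rewrite ?oppr_gt0// oppr_eq0 lt_eqF.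
  split=> [|A mA]; first exact: oppr_measurable.
  by rewrite mul1e; exact: lebesgue_measureN.
have a_neq0 : a != 0 by rewrite gt_eqF.
have maff : measurable_fun [set: R] (fun x => a * x + b).
  by apply: measurable_funD => //; exact: mulrl_measurable.
pose phi : measurableTypeR R -> measurableTypeR R := fun x : R => a * x + b.
split=> // A mA; rewrite gtr0_norm// -[X in X @^-1` _]/phi.
suff -> : lambda A = (a%:E * pushforward lambda phi A)%E.
  by rewrite muleA -EFinM mulVf// mul1e.
pose nu : {measure set (measurableTypeR R) -> \bar R} :=
  mscale (NngNum (ltW a0)) (pushforward lambda phi).
rewrite (@lebesgue_measure_unique _ (nu maff))// => _ [[u v]] _ <-/=.
rewrite /mscale/= /pushforward.
have -> : phi @^-1` `]u, v]%classic =
    `](u - b) / a, (v - b) / a]%classic.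
  apply/seteqP; split=> x /=; rewrite !in_itv/= ltr_pdivrMr// ler_pdivlMr//;
    by rewrite ltrBlDr lerBrDr [x * a]mulrC.
rewrite !lebesgue_measure_itv/= !lte_fin ltr_pM2r ?invr_gt0// ltrD2r.
case: ifP => _; last by rewrite mule0.
by rewrite -!EFinB -EFinM -mulrBl mulrCA divff// mulr1 opprB addrA subrK.
Qed.

Section product_swap.
Context {d1 d2} {T1 : measurableType d1} {T2 : measurableType d2}.
Variables (m1 : {sigma_finite_measure set T1 -> \bar R}).
Variables (m2 : {measure set T2 -> \bar R}).
Hypothesis sf : sigma_finite setT m2.

(** A copy of [m2] that can carry the sigma-finite structure given by [sf]; [lebesgue] is typed only
    as a measure. *)
Let m : set T2 -> \bar R := m2.
HB.instance Definition _ := Measure.on m.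
HB.instance Definition _ := @Measure_isSigmaFinite.Build _ _ _ m sf.

(** Both orders of integration agree on rectangles, so uniqueness applies. The definition of
    [lebesgue] slices along the first coordinate, while maps acting on the remaining ones need the
    other slicing. *)
Lemma product_measure12E B : measurable B ->
  (m1 \x m2)%E B = (m1 \x^ m2)%E B.
Proof.
move=> mB.
by rewrite -(@product_measure_unique _ _ _ _ _ m1 m (m1 \x^ m)%E)// =>
  *; exact: product_measure2E.
Qed.

(** Each section at fixed [x] is scaled by the same [r], although [psi x] varies with [x]. *)
Lemma product_measure2_fibre (psi : T1 -> T2 -> T2) (r : R) B : 0 <= r ->
  (forall x, scales m2 (psi x) r) -> measurable B ->
  measurable [set z | B (z.1, psi z.1 z.2)] ->
  (m1 \x^ m2)%E [set z | B (z.1, psi z.1 z.2)] = (r%:E * (m1 \x^ m2) B)%E.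
Proof.
move=> r0 spsi mB mB'; rewrite -!product_measure12E// /product_measure1.
rewrite -ge0_integralZl_EFin//; last first.
  exact: (@measurable_fun_xsection _ _ _ _ _ m).
apply: eq_integral => x _ /=.
rewrite -(spsi x).2; last exact: measurable_xsection.
by congr (m2 _); apply/seteqP; split=> y; rewrite /xsection/= !inE.
Qed.

End product_swap.

(** At fixed second coordinate, [g] is a mere translation of the line, so every section is scaled by
    the inverse of [|a|]. *)
Lemma product_measure2_shear disp (T : measurableType disp)
    (mu : {measure set T -> \bar R}) (a : R) (g : T -> R) B : a != 0 ->
  measurable B ->
  (lambda \x^ mu)%E [set z | B (a * z.1 + g z.2, z.2)] =
  (`|a|^-1%:E * (lambda \x^ mu) B)%E.
Proof.
move=> a0 mB; rewrite /product_measure2 -ge0_integralZl_EFin//;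
  last exact: measurable_fun_ysection.
apply: eq_integral => y _ /=.
rewrite -(scales_lebesgue_measure (g y) a0).2; last exact: measurable_ysection.
by congr (lambda _); apply/seteqP; split=> x; rewrite /ysection/= !inE.
Qed.

Lemma consvE d (z : R * 'cV[R]_d) : consv z = col_mx z.1%:M z.2.
Proof.
apply/matrixP => i j; rewrite !mxE [j]ord1.
case: (@split_ordP 1 d i) => k ->; rewrite ?mxE; case: unliftP => [l kl|kl].
- by move/(congr1 val): kl; rewrite [k]ord1.
- by rewrite [k]ord1 mulr1n.
- by congr (z.2 _ 0); apply/val_inj; move/(congr1 val): kl => /= [].
- by move/(congr1 val): kl.
Qed.

(** Since [lebesgue R d.+1] is the image of a product measure under [consv], it suffices to treat
    the conjugate map [Phi] on the product. *)
Lemma scales_consv d (phi : 'cV[R]_d.+1 -> 'cV[R]_d.+1) Phi r :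
  measurable_fun setT phi -> (forall z, phi (consv z) = consv (Phi z)) ->
  (forall B, measurable B -> measurable (Phi @^-1` B) ->
    (lambda \x^ lebesgue R d)%E (Phi @^-1` B) =
    (r%:E * (lambda \x^ lebesgue R d) B)%E) ->
  measurable_fun setT Phi ->
  scales (lebesgue R d.+1) phi r.
Proof.
move=> mphi phiE PhiB mPhi; split=> // A mA; rewrite /= /leb_succ /pushforward.
have mB : measurable (@consv R d @^-1` A).
  by rewrite -[X in measurable X]setTI; exact: measurable_consv.
rewrite -PhiB//; last by rewrite -[X in measurable X]setTI; exact: mPhi.
by congr product_measure2; apply/seteqP; split=> z /=; rewrite phiE.
Qed.

Lemma block_affineE d (a x b0 : R) (r : 'rV[R]_d) (c y b1 : 'cV[R]_d)
    (B : 'M[R]_d) :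
  block_mx a%:M r c B *m col_mx x%:M y + col_mx b0%:M b1 =
  col_mx (a * x + ((r *m y) 0 0 + b0))%:M (B *m y + (x *: c + b1)).
Proof.
rewrite mul_block_col add_col_mx; congr col_mx; last first.
  by rewrite mul_mx_scalar [_ + B *m y]addrC addrA.
apply/matrixP => i j; rewrite !ord1 mul_scalar_mx !mxE eqxx !mulr1n.
by rewrite addrA.
Qed.

Lemma scales_upper_block d (a b : R) (r : 'rV[R]_d) : a != 0 ->
  scales (lebesgue R d.+1) (fun z : 'cV[R]_(1 + d) =>
    block_mx a%:M r 0 1%:M *m z + col_mx b%:M 0) `|a|^-1.
Proof.
move=> a0; pose g (y : 'cV[R]_d) := (r *m y) 0 0 + b.
pose Phi (z : R * 'cV[R]_d) := (a * z.1 + g z.2, z.2).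
apply: (@scales_consv _ _ Phi).
- exact: (@measurable_affine (1 + d) (1 + d)).
- move=> z; rewrite !consvE block_affineE /=.
  by rewrite mul1mx scaler0 !addr0.
- by move=> B mB _; exact: product_measure2_shear.
- have mr : measurable_fun setT (fun y : 'cV[R]_d => (r *m y) 0 0).
    have := measurableT_comp (measurable_coord 0) (@measurable_affine _ 1 r 0).
    by congr measurable_fun; apply/funext => y /=; rewrite addr0.
  apply/measurable_fun_pair => /=; last exact: measurable_snd.
  apply: measurable_funD; first exact: measurable_funM.
  by apply: measurable_funD => //; exact: (measurableT_comp mr measurable_snd).
Qed.

(** The first coordinate [x] is fixed and adds [x *: c] to the translation of the others, hence the
    assumption for every [b']. *)
Lemma scales_lower_block d (c b : 'cV[R]_d) (B : 'M[R]_d) (s : R) : 0 <= s ->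
  (forall b', scales (lebesgue R d) (fun y => B *m y + b') s) ->
  scales (lebesgue R d.+1) (fun z : 'cV[R]_(1 + d) =>
    block_mx 1%:M 0 c B *m z + col_mx 0 b) s.
Proof.
move=> s0 sB; pose psi (x : R) y := B *m y + (x *: c + b).
pose Phi (z : R * 'cV[R]_d) := (z.1, psi z.1 z.2).
have mPhi : measurable_fun setT Phi.
  apply/measurable_fun_pair; first exact: measurable_fst.
  apply: measurable_fun_col => i; rewrite /psi.
  under eq_fun do rewrite !mxE.
  apply: measurable_funD.
    apply: measurable_sum => j; apply: measurable_funM => //.
    exact: (measurableT_comp (measurable_coord j) measurable_snd).
  by apply: measurable_funD => //; exact: measurable_funM.
apply: (@scales_consv _ _ Phi) => //.
- exact: (@measurable_affine (1 + d) (1 + d)).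
- move=> z; rewrite !consvE.
  have -> : (0 : 'M[R]_1) = 0%:M.
    by apply/matrixP => i j; rewrite !mxE mul0rn.
  by rewrite block_affineE /= mul0mx mxE !addr0 mul1r.
- move=> A mA mPA.
  apply: product_measure2_fibre => //; first exact: sigma_finite_lebesgue.
  by move=> x; exact: sB.
Qed.

(* Induction on the dimension through the block factorization of [A] whose
   Schur complement is taken at the top left entry; a shear makes this entry
   nonzero. *)
Lemma scales_affine d (A : 'M[R]_d) (b : 'cV[R]_d) : \det A != 0 ->
  scales (lebesgue R d) (fun x => A *m x + b) `|\det A|^-1.
Proof.
elim: d A b => [|d IH] A b detA.
  split=> [|S mS]; first exact: measurable_affine.
  rewrite det_mx00 normr1 invr1 mul1e; congr (_ _).
  by apply/seteqP; split=> x /=; rewrite [_ + _](flatmx0 _) [x]flatmx0.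
wlog a0 : A b detA / (A : 'M[R]_(1 + d)) 0 0 != 0 => [wlg|].
  have [a0|] := eqVneq ((A : 'M[R]_(1 + d)) 0 0) 0; last exact: wlg.
  pose r : 'rV[R]_d := ursubmx (A : 'M[R]_(1 + d)).
  (* With a vanishing corner, a zero rest of the top row would make the determinant vanish. *)
  have [j rj] : exists j, r 0 j != 0.
    apply/existsP; apply: contraNT detA; rewrite negb_exists => /forallP r0.
    have rE : r = 0.
      apply/rowP => j; rewrite [RHS]mxE; apply/eqP.
      by rewrite -[_ == _]negbK r0.
    rewrite -[A](@submxK _ 1 d 1 d) -/r rE (@det_lblock _ 1 d).
    by rewrite det_mx11 !mxE lshift0 a0 mul0r.
  (* Right multiplication by [S 1] adds the column of [r 0 j] to the first one, so that the corner
     becomes [r 0 j]. *)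
  pose S e : 'M[R]_(1 + d) := block_mx 1%:M 0 (e *: delta_mx j 0) 1%:M.
  have SK : S 1 *m S (-1) = 1%:M.
    rewrite mulmx_block !mulmx1 !mul1mx !mulmx0 !mul0mx !addr0 add0r.
    by rewrite -scalerDl subrr scale0r -scalar_mx_block.
  have detS e : \det (S e) = 1 by rewrite det_lblock !det1 mulr1.
  have -> : (fun x => A *m x + b) =
     (fun x => (A *m S 1) *m x + b) \o
       (fun x : 'cV[R]_(1 + d) => S (-1) *m x + col_mx 0 0).
    apply/funext => x /=.
    by rewrite col_mx0 addr0 mulmxA -[A *m S 1 *m _]mulmxA SK mulmx1.
  have -> : \det A = \det (A *m S 1) by rewrite det_mulmx detS mulr1.
  rewrite -[_^-1]mulr1.
  apply: scales_comp.
    apply: wlg; first by rewrite det_mulmx (detS 1) mulr1.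
    rewrite -[A](@submxK _ 1 d 1 d) /S (@mulmx_block _ 1 d 1 d 1 d).
    have -> : (0 : 'I_(1 + d)) = lshift d 0 by apply/val_inj.
    rewrite block_mxEul mulmx1 scale1r -colE !mxE lshift0 a0 add0r.
    by move: rj; rewrite !mxE lshift0.
  rewrite /S; apply: scales_lower_block => // b'.
  by have := IH 1%:M b'; rewrite det1 normr1 invr1; apply; exact: oner_neq0.

pose a := (A : 'M[R]_(1 + d)) 0 0.
pose r : 'rV[R]_d := ursubmx (A : 'M[R]_(1 + d)).
pose c : 'cV[R]_d := dlsubmx (A : 'M[R]_(1 + d)).
pose C : 'M[R]_d := drsubmx (A : 'M[R]_(1 + d)) - a^-1 *: (c *m r).
pose L : 'M[R]_(1 + d) := block_mx 1%:M 0 (a^-1 *: c) C.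
pose U : 'M[R]_(1 + d) := block_mx a%:M r 0 1%:M.
have AE : A = L *m U.
  rewrite -[LHS](@submxK _ 1 d 1 d) -/r -/c mulmx_block !mul1mx !mul0mx.
  rewrite !mulmx0 !addr0 !mulmx1 mul_mx_scalar scalerA divff// scale1r.
  rewrite -scalemxAl addrC subrK [ulsubmx _](_ : _ = a%:M)//.
  apply/matrixP => i j; rewrite !ord1 !mxE eqxx mulr1n /a.
  by congr (A _ _); apply/val_inj.
have detAE : \det A = a * \det C.
  rewrite AE det_mulmx (@det_lblock _ 1 d) (@det_ublock _ 1 d).
  by rewrite !det_scalar1 !det1 mul1r mulr1 mulrC.
have detC : \det C != 0.
  by move: detA; rewrite detAE mulf_eq0 negb_or => /andP[].
pose b0 := (b : 'cV[R]_(1 + d)) 0 0.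
pose b1 : 'cV[R]_d := dsubmx (b : 'cV[R]_(1 + d)).
have bE : b = col_mx b0%:M b1.
  rewrite -[LHS](@vsubmxK _ 1 d) [usubmx _](_ : _ = b0%:M)//.
  apply/matrixP => i j; rewrite !ord1 !mxE eqxx mulr1n /b0.
  by congr (b _ _); apply/val_inj.
(* The translation is split between the factors: [L] sends [col_mx b0%:M 0] to [b0] above
   [b0 *: (a^-1 *: c)], and the second translation corrects the lower part to [b1]. *)
have -> : (fun x => A *m x + b) =
    (fun x : 'cV[R]_(1 + d) => L *m x + col_mx 0 (b1 - b0 *: (a^-1 *: c))) \o
    (fun x : 'cV[R]_(1 + d) => U *m x + col_mx b0%:M 0).
  apply/funext => x /=; rewrite mulmxDr mulmxA -AE -addrA; congr (_ + _).
  rewrite mul_block_col add_col_mx mul1mx mul0mx mulmx0 !addr0.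
  by rewrite mul_mx_scalar [_ *: _ + _]addrC subrK.
rewrite detAE normrM invfM mulrC; apply: scales_comp.
  by apply: scales_lower_block => // b'; exact: IH.
exact: scales_upper_block.
Qed.

End lebesgue_affine.

Local Open Scope complex_scope.

(** * Real multiples of complex numbers *)

Section complex_scaling.
Variable R : realType.

Lemma Re_scale (c : R) (z : R[i]) :
  complex.Re (c%:C * z) = c * complex.Re z.
Proof. by case: z => a b /=; rewrite mul0r subr0. Qed.

Lemma Im_scale (c : R) (z : R[i]) :
  complex.Im (c%:C * z) = c * complex.Im z.
Proof. by case: z => a b /=; rewrite mul0r addr0. Qed.

Lemma conj_scale (c : R) (z : R[i]) :
  Num.conj (c%:C * z) = c%:C * Num.conj z.
Proof. by rewrite rmorphM; congr (_ * _); exact: conjc_real. Qed.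

Lemma cabs_scale (c : R) (z : Cplx R) : 0 <= c -> cabs (c%:C * z) = c * cabs z.
Proof.
move=> c0; rewrite /cabs normrM -Re_scale; congr (complex.Re (_ * _)).
by rewrite ger0_norm// lecR.
Qed.

Lemma cabs_ge0 (z : Cplx R) : 0 <= cabs z.
Proof. by rewrite /cabs; case: z => a b /=; exact: sqrtr_ge0. Qed.

End complex_scaling.

(** * Weighted composition operators on classes, and their Fourier transforms *)

Section weighted_composition.
Variables (R : realType) (d : nat).
Local Notation V := 'cV[R]_d.
Local Notation mu := (lebesgue R d).
Implicit Types (A : 'M[R]_d) (b : V) (f g : V -> Cplx R) (x y : aefun R d).

Definition wcomp A b f : V -> Cplx R :=
  fun t => (Num.sqrt `|\det A|)%:C * f (A *m t + b).

Definition wcomp_op A b x : aefun R d := aeclass (wcomp A b (repr x)).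

Lemma aeclassP f g : aeclass f = aeclass g <-> f = g %[ae mu].
Proof.
split=> [/eqquotP/asboolP//|fg].
by apply/eqquotP/asboolP.
Qed.

Lemma repr_aeclass f : repr (aeclass f) = f %[ae mu].
Proof. by apply/aeclassP; rewrite /aeclass reprK. Qed.

Lemma aeclass_repr x : aeclass (repr x) = x.
Proof. by rewrite /aeclass reprK. Qed.

Section inverse.
Variables (A : 'M[R]_d) (b : V).
Hypothesis detA : \det A != 0.

Let uA : A \in unitmx. Proof. by rewrite unitmxE unitfE. Qed.

Lemma affineK : cancel (fun t : V => A *m t + b)
  (fun t : V => invmx A *m t + - (invmx A *m b)).
Proof. by move=> t; rewrite mulmxDr mulKmx// addrK. Qed.

Lemma affineVK : cancel (fun t : V => invmx A *m t + - (invmx A *m b))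
  (fun t : V => A *m t + b).
Proof. by move=> t; rewrite mulmxDr mulKVmx// mulmxN mulKVmx// subrK. Qed.

Lemma det_invmx_neq0 : \det (invmx A) != 0.
Proof. by rewrite det_inv invr_eq0. Qed.

Let s0 : 0 < Num.sqrt `|\det A|.
Proof. by rewrite sqrtr_gt0 normr_gt0. Qed.

Lemma wcompK : cancel (wcomp A b) (wcomp (invmx A) (- (invmx A *m b))).
Proof.
move=> f; apply/funext => t; rewrite /wcomp affineVK mulrA.
rewrite det_inv normfV sqrtrV// -rmorphM mulVf ?mul1r//.
by rewrite gt_eqF.
Qed.

Lemma wcompVK : cancel (wcomp (invmx A) (- (invmx A *m b))) (wcomp A b).
Proof.
move=> f; apply/funext => t; rewrite /wcomp affineK mulrA.
rewrite det_inv normfV sqrtrV// -rmorphM mulfV ?mul1r//.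
by rewrite gt_eqF.
Qed.

(** Affine bijections pull null sets back to null sets, so [wcomp] descends to classes. *)
Lemma wcomp_ae f g : f = g %[ae mu] -> wcomp A b f = wcomp A b g %[ae mu].
Proof.
move=> fg; apply: (negligibleS _ (negligible_scales (scales_affine b detA) fg)).
by move=> t /=; apply: contra_not => fgt _; rewrite /wcomp fgt.
Qed.

Lemma wcomp_op_aeclass f : wcomp_op A b (aeclass f) = aeclass (wcomp A b f).
Proof. by apply/aeclassP/wcomp_ae/repr_aeclass. Qed.

Lemma cint_affine c f : 0 < c ->
  cint setT (fun t => c%:C * f (A *m t + b)) =
  (c / `|\det A|)%:C * cint setT f.
Proof.
move=> c0; rewrite /cint; under eq_Rintegral do rewrite Re_scale.
under [X in _ +i* X]eq_Rintegral do rewrite Im_scale.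
have sA := scales_affine b detA.
have d0 : 0 < `|\det A|^-1 by rewrite invr_gt0 normr_gt0.
have mV := @measurable_affine R d d (invmx A) (- (invmx A *m b)).
rewrite (Rintegral_scales (fun t => complex.Re (f t)) affineK affineVK mV
  d0 c0 sA).
rewrite (Rintegral_scales (fun t => complex.Im (f t)) affineK affineVK mV
  d0 c0 sA).
by simpc.
Qed.

Lemma ge0_integral_affine c (h : V -> R) : 0 < c -> (forall t, 0 <= h t) ->
  (\int[mu]_t (c * h (A *m t + b))%:E =
   (c / `|\det A|)%:E * \int[mu]_t (h t)%:E)%E.
Proof.
move=> c0 h0; under eq_integral do rewrite EFinM.
have mV := @measurable_affine R d d (invmx A) (- (invmx A *m b)).
have d0 : 0 < `|\det A|^-1 by rewrite invr_gt0 normr_gt0.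
rewrite (ge0_integral_scales (f := EFin \o h) affineK affineVK mV d0 c0)//.
exact: scales_affine.
Qed.

Lemma cmeasurable_wcomp f : cmeasurable f -> cmeasurable (wcomp A b f).
Proof.
have maff := @measurable_affine R d d A b.
move=> [mRe mIm]; split; rewrite /wcomp.
- under eq_fun do rewrite Re_scale.
  by apply: measurable_funM => //; exact: (measurableT_comp mRe maff).
- under eq_fun do rewrite Im_scale.
  by apply: measurable_funM => //; exact: (measurableT_comp mIm maff).
Qed.

(** The square of the weight cancels the Jacobian. *)
Lemma integral_wcomp_sqr f :
  (\int[mu]_t ((cabs (wcomp A b f t)) ^+ 2)%:E =
   \int[mu]_t ((cabs (f t)) ^+ 2)%:E)%E.
Proof.
under eq_integral do rewrite cabs_scale ?sqrtr_ge0// exprMn sqr_sqrtr//.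
rewrite (ge0_integral_affine (h := fun t => cabs (f t) ^+ 2)) ?normr_gt0//.
- by rewrite divff ?mul1e// normr_eq0.
- by move=> t; exact: sqr_ge0.
Qed.

Lemma square_integrable_wcomp f :
  square_integrable f -> square_integrable (wcomp A b f).
Proof.
by move=> [mf f2]; split; [exact: cmeasurable_wcomp|rewrite integral_wcomp_sqr].
Qed.

Lemma absolutely_integrable_wcomp f :
  absolutely_integrable f -> absolutely_integrable (wcomp A b f).
Proof.
move=> [mf f1]; split; first exact: cmeasurable_wcomp.
under eq_integral do rewrite cabs_scale ?sqrtr_ge0//.
rewrite (ge0_integral_affine (h := fun t => cabs (f t)))//; last first.
  by move=> t; exact: cabs_ge0.
by rewrite lte_mul_pinfty// lee_fin divr_ge0// ltW.
Qed.

Lemma wcompB f g t :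
  wcomp A b (fun t => f t - g t) t = wcomp A b f t - wcomp A b g t.
Proof. by rewrite /wcomp mulrBr. Qed.

Lemma cvg_L2_wcomp (f : nat -> V -> Cplx R) x :
  cvg_L2 f x -> cvg_L2 (fun k => wcomp A b (f k)) (wcomp_op A b x).
Proof.
move=> [g [g2 xg fg]]; exists (wcomp A b g); split.
- exact: square_integrable_wcomp.
- by rewrite xg wcomp_op_aeclass.
- apply: cvg_trans fg; apply: near_eq_cvg; apply: nearW => k.
  rewrite -(integral_wcomp_sqr (fun t => f k t - g t)).
  by apply: eq_integral => t _; rewrite wcompB.
Qed.

End inverse.

Lemma wcomp_opK A b : \det A != 0 ->
  cancel (wcomp_op A b) (wcomp_op (invmx A) (- (invmx A *m b))).
Proof.
move=> A0 x; rewrite {2}/wcomp_op wcomp_op_aeclass ?det_invmx_neq0//.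
by rewrite wcompK// aeclass_repr.
Qed.

Lemma wcomp_opVK A b : \det A != 0 ->
  cancel (wcomp_op (invmx A) (- (invmx A *m b))) (wcomp_op A b).
Proof.
move=> A0 x; rewrite {2}/wcomp_op wcomp_op_aeclass//.
by rewrite wcompVK// aeclass_repr.
Qed.

(** Substituting [s = A t] moves the inverse transpose of [A] onto [xi], and the weight divided by
    the Jacobian is the inverse square root of [|\det A|], the weight of the inverse transpose. The
    translation is 0 because a nonzero one would produce a modulation. *)
Lemma fourier_wcomp A f : \det A != 0 ->
  fourier (wcomp A 0 f) = wcomp (invmx A)^T 0 (fourier f).
Proof.
move=> A0; apply/funext => xi; rewrite /fourier.
pose h t := f t * cexp (dot t ((invmx A)^T *m xi)).
transitivity (cint setT
    (fun t => (Num.sqrt `|\det A|)%:C * h (A *m t + 0))).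
  congr cint; apply/funext => t; rewrite /wcomp /h mulrA; congr (_ * cexp _).
  rewrite !addr0; have dotE (u v : V) : dot u v = (u^T *m v) 0 0.
    by rewrite mxE; apply: eq_bigr => i _; rewrite mxE.
  rewrite !dotE trmx_mul mulmxA -[_ *m A^T *m _]mulmxA -trmx_mul.
  by rewrite mulVmx ?unitmxE ?unitfE// trmx1 mulmx1.
rewrite cint_affine ?sqrtr_gt0 ?normr_gt0// /wcomp addr0; congr (_%:C * _).
rewrite det_tr det_inv normfV sqrtrV//.
rewrite -[X in _ / X](@sqr_sqrtr _ `|\det A|)// expr2 invfM mulrA.
rewrite divff ?mul1r//.
by rewrite gt_eqF// sqrtr_gt0 normr_gt0.
Qed.

Lemma is_fourier_wcomp A x p : \det A != 0 -> is_fourier x p ->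
  is_fourier (wcomp_op A 0 x) (wcomp_op (invmx A)^T 0 p).
Proof.
move=> A0 [f [f12 fx fp]]; exists (fun k => wcomp A 0 (f k)); split.
- move=> k; have [f1 f2] := f12 k.
  by split; [exact: absolutely_integrable_wcomp|exact: square_integrable_wcomp].
- exact: cvg_L2_wcomp.
- under eq_fun do rewrite fourier_wcomp//.
  by apply: cvg_L2_wcomp => //; rewrite det_tr det_invmx_neq0.
Qed.

End weighted_composition.

(** * Stability of continuous functions of compact support *)

Section Cc.
Variables (R : realType) (d : nat).
Local Notation V := 'cV[R]_d.
Implicit Types (A : 'M[R]_d) (b : V) (f : V -> Cplx R).

Lemma continuous_col (T : topologicalType) (f : T -> V) :
  (forall i, continuous (fun t => f t i 0)) -> continuous f.
Proof.
move=> cf t; apply/cvg_ballP => e e0.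
have : \forall s \near t, forall i, ball (f t i 0) e (f s i 0).
  by apply: filter_forall => i; move/cvg_ballP: (cf i t); exact.
by apply: filterS => s fs; split => // i j; rewrite [j]ord1; exact: fs.
Qed.

Lemma continuous_affine A b : continuous (fun t : V => A *m t + b).
Proof.
apply: continuous_col => i.
pose F (r : seq 'I_d) (t : V) := \sum_(j <- r) A i j * t j 0.
have cF r : continuous (F r).
  elim: r => [|j r IH].
    have -> : F [::] = cst 0 by apply/funext => t; rewrite /F big_nil.
    exact: cst_continuous.
  have -> : F (j :: r) = (fun t : V => A i j * t j 0) \+ F r.
    by apply/funext => t; rewrite /F big_cons.
  move=> t; apply: continuousD; last exact: IH.
  by apply: continuousM; [exact: cst_continuous|exact: coord_continuous].
have -> : (fun t : V => (A *m t + b) i 0) = F (index_enum 'I_d) \+ cst (b i 0).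
  by apply/funext => t; rewrite !mxE.
by move=> t; apply: continuousD; [exact: cF|exact: cst_continuous].
Qed.

Lemma Cc_wcomp A b f : \det A != 0 -> Cc f -> Cc (wcomp A b f).
Proof.
move=> A0 [cf [K cK fK]]; split.
  move=> t; rewrite /wcomp.
  apply: (@continuous_comp _ _ _ _ (fun z : Cplx R => _ *: z)); last first.
    exact: scaler_continuous.
  by apply: continuous_comp; [exact: continuous_affine|exact: cf].
(* The new support lies in the preimage of [K], written as an image under the inverse map to see
   that it is compact. *)
pose psi := fun t : V => invmx A *m t + - (invmx A *m b).
exists (psi @` K).
  apply: continuous_compact => //; apply: continuous_subspaceT => t.
  exact: continuous_affine.
move=> t Kt; rewrite /wcomp fK ?mulr0// => Kat; apply: Kt.
by exists (A *m t + b) => //; exact: affineK.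
Qed.

End Cc.

(** * Weighted composition as a unitary between the modules [Xmod] *)

Section Xmod_wcomp.
Variables (R : realType) (d : nat) (D : 'M[int]_d.+1).
Local Notation V := 'cV[R]_d.+1.
Implicit Types (A : 'M[R]_d.+1) (b : V) (f g : V -> Cplx R).
Implicit Types (x y : aefun R d.+1) (n m : int).

Definition intertwines A n m :=
  forall h : 'cV[int]_d.+1, A *m shift R D m h = shift R D n h.

Lemma intertwinesV A n m : \det A != 0 ->
  intertwines A n m -> intertwines (invmx A) m n.
Proof. by move=> A0 H h; rewrite -H mulKmx// unitmxE unitfE. Qed.

Lemma transl_wcomp A b n m f h : intertwines A n m ->
  transl_fun D m h (wcomp A b f) = wcomp A b (transl_fun D n h f).
Proof.
move=> An; apply/funext => t; rewrite /transl_fun /wcomp mulmxBr An.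
by rewrite addrAC.
Qed.

Lemma bracket_wcomp A b n m f g : \det A != 0 -> intertwines A n m ->
  bracket D m (wcomp A b f) (wcomp A b g) = bracket D n f g.
Proof.
move=> A0 An; apply/funext => h; rewrite /bracket.
have dA : 0 < `|\det A| by rewrite normr_gt0.
(* Inserting the factor 1 in this form lets [cint_affine] apply with [c] equal to [|\det A|], the
   product of the two weights. *)
have -> : cint setT (fun t => (transl_fun D n h f t)^* * g t) =
    (`|\det A| / `|\det A|)%:C *
    cint setT (fun t => (transl_fun D n h f t)^* * g t).
  by rewrite divff ?gt_eqF// mul1r.
rewrite -(cint_affine b A0 _ dA); congr cint; apply/funext => t.
rewrite (transl_wcomp _ _ _ An) /wcomp conj_scale mulrACA -rmorphM -expr2.
by rewrite sqr_sqrtr.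
Qed.

Lemma Xnorm_wcomp A b n m f : \det A != 0 -> intertwines A n m ->
  Xnorm D m (wcomp A b f) = Xnorm D n f.
Proof. by move=> A0 An; rewrite /Xnorm (bracket_wcomp _ _ _ A0 An). Qed.

Lemma approx_wcomp A b n m (f : nat -> V -> Cplx R) x :
  \det A != 0 -> intertwines A n m -> approx D n f x ->
  approx D m (fun k => wcomp A b (f k)) (wcomp_op A b x).
Proof.
move=> A0 An [fCc fX fx]; split.
- by move=> k; exact: Cc_wcomp.
- move=> e /fX; apply: filterS => N H i j Ni Nj.
  under eq_fun do rewrite -wcompB.
  by rewrite (Xnorm_wcomp _ _ A0 An); exact: H.
- exact: cvg_L2_wcomp.
Qed.

(** [Xinner] chooses an element of a set of limits. Transporting approximating sequences by [A] or
    its inverse keeps the brackets, so the two sets are equal and so are the choices; existence and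
    uniqueness of the limit never enter. *)
Lemma Xinner_wcomp A b n m x y : \det A != 0 -> intertwines A n m ->
  Xinner D m (wcomp_op A b x) y =
  Xinner D n x (wcomp_op (invmx A) (- (invmx A *m b)) y).
Proof.
move=> A0 An; have V0 := det_invmx_neq0 A0; have Vn := intertwinesV A0 An.
apply: (congr1 get); apply/seteqP; split=> a [f [g [fx gy fga]]].
- exists (fun k => wcomp (invmx A) (- (invmx A *m b)) (f k)).
  exists (fun k => wcomp (invmx A) (- (invmx A *m b)) (g k)); split.
  + by rewrite -(wcomp_opK b A0 x); exact: approx_wcomp.
  + exact: approx_wcomp.
  + by under eq_fun do rewrite (bracket_wcomp _ _ _ V0 Vn).
- exists (fun k => wcomp A b (f k)), (fun k => wcomp A b (g k)); split.
  + exact: approx_wcomp.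
  + by rewrite -(wcomp_opVK b A0 y); exact: approx_wcomp.
  + by under eq_fun do rewrite (bracket_wcomp _ _ _ A0 An).
Qed.

Lemma unitary_wcomp A b n m : \det A != 0 -> intertwines A n m ->
  unitary (Xmod R D n) (Xmod R D m) (wcomp_op A b).
Proof.
move=> A0 An; have V0 := det_invmx_neq0 A0; have Vn := intertwinesV A0 An.
exists (wcomp_op (invmx A) (- (invmx A *m b))); split; first split.
- by move=> x [f fx]; exists (fun k => wcomp A b (f k)); exact: approx_wcomp.
- move=> y [g gy]; exists (fun k => wcomp (invmx A) (- (invmx A *m b)) (g k)).
  exact: approx_wcomp.
- by move=> x y _ _; exact: Xinner_wcomp.
- by move=> x _; exact: wcomp_opK.
- by move=> y _; exact: wcomp_opVK.
Qed.

End Xmod_wcomp.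

(** * Isomorphism of Hilbert modules as an equivalence relation *)

Section unitary_equivalence.
Variable A : Type.

(** An [hmodule] carries no Hermitian symmetry with which to swap the arguments, so [x] is written
    [s (t x)] and the adjoint relation is used backwards. *)
Lemma unitary_sym V W (E : hmodule V A) (F : hmodule W A) t :
  unitary E F t -> exists s, unitary F E s.
Proof.
move=> [s [[tE sF ts] st tsK]]; exists s, t; split => //; split => //.
move=> y x Fy Ex; rewrite -[x in LHS]st// -ts ?tsK//; first exact: sF.
exact: tE.
Qed.

Lemma isomorphic_refl V (E : hmodule V A) : isomorphic E E.
Proof. by exists id, id; split. Qed.

Lemma isomorphic_sym V W (E : hmodule V A) (F : hmodule W A) :
  isomorphic E F -> isomorphic F E.
Proof. by move=> [t /unitary_sym]. Qed.

Lemma isomorphic_trans V W U (E : hmodule V A) (F : hmodule W A)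
    (G : hmodule U A) : isomorphic E F -> isomorphic F G -> isomorphic E G.
Proof.
move=> [t [t' [[tE t'F tt'] t'K tK]]] [s [s' [[sF s'G ss'] s'K sK]]].
exists (s \o t), (t' \o s'); split; first split.
- by move=> x /tE/sF.
- by move=> y /s'G/t'F.
- by move=> x y Ex Gy /=; rewrite ss' ?tt'//; [exact: s'G|exact: tE].
- by move=> x Ex /=; rewrite s'K ?t'K//; exact: tE.
- by move=> y Gy /=; rewrite tK ?sK//; exact: s'G.
Qed.

Lemma isomorphic_int V (X : int -> hmodule V A) :
  (forall n, isomorphic (X n) (X (n + 1))) ->
  forall n k, isomorphic (X n) (X k).
Proof.
move=> iso1; have iso_nat n (j : nat) : isomorphic (X n) (X (n + j%:Z)).
  elim: j => [|j IH]; first by rewrite addr0; exact: isomorphic_refl.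
  apply: isomorphic_trans IH _.
  by rewrite -addn1 PoszD addrA; exact: iso1.
move=> n k; have [nk|/ltW kn] := leP n k.
  have -> : k = n + `|k - n|%N%:Z.
    by rewrite gez0_abs ?subr_ge0// [RHS]addrC subrK.
  exact: iso_nat.
apply: isomorphic_sym.
have -> : n = k + `|n - k|%N%:Z.
  by rewrite gez0_abs ?subr_ge0// [RHS]addrC subrK.
exact: iso_nat.
Qed.

End unitary_equivalence.

(** * Reindexing unconditional sums *)

Local Open Scope fset_scope.

Lemma partial_sumE (I : choiceType) (U : zmodType) (w : I -> U) (P : {fset I}) :
  partial_sum w P = \sum_(i <- P) w i.
Proof. by rewrite big_seq_fsetE. Qed.

Lemma cvg_partial_sum_comp (I J : choiceType) (U : zmodType)
    (F : set_system U) (w : J -> U) (g : I -> J) (h : J -> I) :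
  cancel g h -> cancel h g ->
  partial_sum w @ totally `=>` F -> partial_sum (w \o g) @ totally `=>` F.
Proof.
move=> gK hK wF.
have -> : partial_sum (w \o g) = partial_sum w \o (fun P => g @` P).
  apply/funext => P /=; rewrite !partial_sumE.
  by rewrite big_imfset//= => x y _ _; exact: (can_inj gK).
(* Once [Q] contains the image of [P] under [h], its image under [g] contains [P]. *)
move=> S /wF[P _ PS]; exists (h @` P) => //= Q hPQ; apply: PS => /=.
apply/fsubsetP => y yP; rewrite -(hK y) in_imfset//=.
by apply: (fsubsetP hPQ); rewrite in_imfset.
Qed.

Local Close Scope fset_scope.

(** * The dilation and its Fourier transform *)

Section dilation_unitary.
Variables (R : realType) (d : nat) (D : 'M[int]_d.+1).
Local Notation V := 'cV[R]_d.+1.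
Local Notation mu := (lebesgue R d.+1).
Hypothesis dilD : dilation_matrix R D.
Local Notation M := (Dmx R D).

(** A zero determinant would make 0 an eigenvalue, as it is up to sign the constant term of the
    characteristic polynomial. *)
Lemma det_dilation_matrix : \det M != 0.
Proof.
apply/negP => /eqP detM.
have : eigenvalue (map_mx intr D : 'M[R[i]]_d.+1) 0.
  rewrite eigenvalue_root_char rootE horner_coef0 char_poly_det det_map_mx.
  move: detM; rewrite det_map_mx => /eqP; rewrite intr_eq0 => /eqP ->.
  by rewrite mulr0.
by move/dilD; rewrite normr0 ltr10.
Qed.

Let M0 := det_dilation_matrix.

Lemma norm_det_Dmx : `|\det M| = absdet R D.
Proof. by rewrite /absdet det_map_mx intr_norm. Qed.

Lemma Dmx_unit : M \is a GRing.unit.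
Proof. by rewrite -[_ \is a _]/(M \in unitmx) unitmxE unitfE. Qed.

Lemma intertwines1 n : intertwines D (1%:M : 'M[R]_d.+1) n n.
Proof. by move=> h; rewrite mul1mx. Qed.

Lemma intertwines_Dmx n : intertwines D M n (n + 1).
Proof.
move=> h; rewrite /shift mulmxA opprD addrC -[M in M *m _]expr1z.
rewrite -[X in X *m _]/(M ^ 1 * M ^ (-1 - n)) -exprzDr ?Dmx_unit//.
by rewrite addrA subrr add0r.
Qed.

Lemma det_trmxV : \det (M^T^-1) = (\det M)^-1.
Proof. by rewrite [\det _](det_inv M^T) det_tr. Qed.

Lemma translE n g : transl D n g = wcomp_op 1%:M (- shift R D n g).
Proof.
apply/funext => x; congr aeclass; apply/funext => t.
by rewrite /wcomp det1 normr1 sqrtr1 mul1r mul1mx.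
Qed.

Lemma dilE : dil D = wcomp_op M 0.
Proof.
apply/funext => x; congr aeclass; apply/funext => t.
by rewrite /wcomp norm_det_Dmx addr0.
Qed.

Lemma dil_hatE : dil_hat D = wcomp_op (M^T^-1) 0.
Proof.
apply/funext => p; congr aeclass; apply/funext => t.
by rewrite /wcomp det_trmxV normfV norm_det_Dmx sqrtrV ?addr0// normr_ge0.
Qed.

Lemma tproj_eq (t u : V) : tproj t = tproj u <->
  exists k : 'cV[int]_d.+1, t - u = intv R k.
Proof.
by split=> [/eqquotP/asboolP//|tu]; apply/eqquotP/asboolP.
Qed.

Let P : 'M[R]_d.+1 := M^T.

Let detP : \det P != 0. Proof. by rewrite det_tr. Qed.

Let P_unit : P \is a GRing.unit.
Proof. by rewrite -[_ \is a _]/(P \in unitmx) unitmxE unitfE. Qed.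

Let det_exprz n : \det (P ^ n) != 0.
Proof.
have : P ^ n \is a GRing.unit by rewrite unitrXz.
by rewrite -[_ \is a _]/(P ^ n \in unitmx) unitmxE unitfE.
Qed.

(* The union of the fibres meeting a null set is a countable union of affine
   images of this set. *)
Lemma ae_fibre n (Q : V -> Prop) : (\forall xi \ae mu, Q xi) ->
  \forall t \ae mu, forall xi, iota_hat D n xi = tproj t -> Q xi.
Proof.
move=> aeQ.
have PK : P ^ n *m P ^ (- n) = 1%:M.
  by rewrite -[LHS]/(P ^ n * P ^ (- n)) -exprzDr// subrr expr0z.
(* A point [xi] of the fibre over [t] satisfies [P ^ (- n) *m xi = t + k] for an integer vector [k];
   [N k] collects the [t] whose point with offset [k] is bad. *)
pose N k := [set t : V | ~ Q (P ^ n *m t + P ^ n *m intv R k)].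
suff negN : mu.-negligible
    (\bigcup_i (if choice.unpickle i is Some k then N k else set0)).
  apply: (negligibleS _ negN) => t /=.
  move=> /existsNP[xi /not_implyP[/tproj_eq[k xik] nQ]].
  exists (choice.pickle k) => //; rewrite choice.pickleK /N /= -mulmxDr -xik.
  rewrite [t + _]addrC subrK.
  by rewrite mulmxA PK mul1mx.
apply: negligible_bigcup => i.
case: choice.unpickle => [k|]; last exact: negligible_set0.
exact: (negligible_scales (scales_affine _ (det_exprz n)) aeQ).
Qed.

(** Multiplication by [P^-1] maps the fibre of level [n + 1] over a point onto that of level [n],
    and with [m = absdet R D] the constants match: [m ^ (n + 1)] times [m ^ (-1/2)] is [m ^ n] times
    [m ^ (1/2)]. The hypotheses hold only almost everywhere, as representatives of classes are
    chosen. *)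
Lemma Xhat_inner_dilation n (p q p' q' : aefun R d.+1) :
  repr p' = wcomp P^-1 0 (repr p) %[ae mu] ->
  repr q' = wcomp P 0 (repr q) %[ae mu] ->
  Xhat_inner D (n + 1) p' q = Xhat_inner D n p q'.
Proof.
move=> pp' qq'.
pose u t xi := (absdet R D ^ (n + 1))%:C *
  patch (fun=> 0) [set xi | iota_hat D (n + 1) xi = tproj t]
    (fun xi => Num.conj (repr p' xi) * repr q xi : Cplx R) xi.
pose v t xi := (absdet R D ^ n)%:C *
  patch (fun=> 0) [set xi | iota_hat D n xi = tproj t]
    (fun xi => Num.conj (repr p xi) * repr q' xi : Cplx R) xi.
have PK : cancel (mulmx P^-1 : V -> V) (mulmx P).
  by move=> t; rewrite mulmxA -[P *m _]/(P * P^-1) mulrV// mul1mx.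
have PVK : cancel (mulmx P : V -> V) (mulmx P^-1).
  by move=> t; rewrite mulmxA -[P^-1 *m _]/(P^-1 * P) mulVr// mul1mx.
have fibre xi : iota_hat D (n + 1) xi = iota_hat D n (P^-1 *m xi).
  by rewrite /iota_hat -/P mulmxA opprD exprzDr// exprN1.
have absP : absdet R D = `|\det P| by rewrite det_tr norm_det_Dmx.
have m0 : absdet R D != 0 by rewrite absP normr_eq0.
(* By [ae_fibre], for almost every [t] both hypotheses hold on the entire fibre, so the summands
   agree at every point. *)
have uv : \forall t \ae mu, u t = v t \o mulmx P^-1.
  have := @ae_fibre n _ qq'; have := @ae_fibre (n + 1) _ pp'.
  apply: filterS2 => t p't q't; apply/funext => xi /=.
  rewrite /u /v /patch.
  have -> : (xi \in [set xi | iota_hat D (n + 1) xi = tproj t]) =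
      (P^-1 *m xi \in [set xi | iota_hat D n xi = tproj t]).
    by apply/idP/idP; rewrite !inE /= fibre.
  case: ifPn => [|_]; last by rewrite !mulr0.
  rewrite inE => xit; rewrite p't ?q't ?fibre// /wcomp conj_scale !addr0 PK.
  rewrite [\det P^-1](det_inv P) normfV sqrtrV// -absP exprzDr ?unitfE// expr1z.
  set s := Num.sqrt (absdet R D).
  have sE : absdet R D * s^-1 = s.
    have s0 : s != 0 by rewrite gt_eqF// sqrtr_gt0 absP normr_gt0.
    by rewrite -[absdet R D]sqr_sqrtr ?absP// -absP expr2 mulfK.
  have scaleE (a b : R) (z w : R[i]) :
      (a * absdet R D)%:C * (b%:C * z * w) =
      a%:C * (z * ((absdet R D * b)%:C * w)).
    rewrite !rmorphM -!mulrA; congr (_ * _); rewrite [RHS]mulrCA.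
    by congr (_ * _); rewrite mulrCA.
  by rewrite -[in RHS]sE; exact: scaleE.
(* Moving the constant inside the sum turns both conditions into convergence of the partial sums of
   [u t] and [v t]. *)
have cvgE (c : Cplx R) (w : V -> Cplx R) (l : Cplx R) :
    ((fun F => c * partial_sum w F) @ totally --> l) =
    (partial_sum (fun xi => c * w xi) @ totally --> l).
  suff -> : (fun F => c * partial_sum w F) =
      partial_sum (fun xi => c * w xi) by [].
  by apply/funext => F; rewrite !partial_sumE mulr_sumr.
apply: (congr1 get); apply/seteqP; split=> phi /= phit.
- apply: filterS2 uv phit => t uvt; rewrite !cvgE -/(u t) -/(v t) uvt.
  have {2}-> : v t = (v t \o mulmx P^-1) \o mulmx P.
    by apply/funext => xi /=; rewrite PVK.
  exact: cvg_partial_sum_comp.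
- apply: filterS2 uv phit => t uvt; rewrite !cvgE -/(u t) -/(v t) uvt.
  exact: cvg_partial_sum_comp.
Qed.

(** The carriers correspond because [dil_hat D] is the Fourier conjugate of [dil D]: the transform
    of [x] goes to that of the dilated [x]. The adjoint is the inverse operator, that of [P]. *)
Lemma unitary_dil_hat n :
  unitary (Xhatmod R D n) (Xhatmod R D (n + 1)) (dil_hat D).
Proof.
have detPV : \det P^-1 != 0 by rewrite [\det _](det_inv P) invr_eq0.
have VE : invmx P^-1 = P by exact: invmxK.
(* The inverse of a weighted composition without translation has translation [- (B *m 0)], which
   must be recognized as 0. *)
have inv0 (B : 'M[R]_d.+1) : - (B *m 0) = 0 :> V by rewrite mulmx0 oppr0.
have MV : (invmx M)^T = P^-1 by rewrite trmx_inv.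
rewrite dil_hatE; exists (wcomp_op P 0); split; first split.
- move=> p [x [f fx] xp]; exists (wcomp_op M 0 x).
    exists (fun k => wcomp M 0 (f k)).
    exact: approx_wcomp M0 (intertwines_Dmx n) fx.
  by rewrite -/P -MV; exact: is_fourier_wcomp.
- move=> q [y [g gy] yq]; exists (wcomp_op (invmx M) 0 y).
    exists (fun k => wcomp (invmx M) 0 (g k)).
    have Vn := intertwinesV M0 (intertwines_Dmx n).
    exact: approx_wcomp (det_invmx_neq0 M0) Vn gy.
  rewrite /P -[M in M^T](invmxK M).
  by apply: is_fourier_wcomp => //; exact: det_invmx_neq0.
- by move=> p q _ _; apply: Xhat_inner_dilation; exact: repr_aeclass.
- by move=> p _; have := wcomp_opK 0 detPV p; rewrite VE inv0.
- by move=> q _; have := wcomp_opVK 0 detPV q; rewrite VE inv0.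
Qed.

End dilation_unitary.

Theorem corollary4p6 (R : realType) (d : nat) (D : 'M[int]_d.+1) :
  dilation_matrix R D ->
  [/\ forall (n : int) (g : 'cV[int]_d.+1),
        unitary (Xmod R D n) (Xmod R D n) (transl D n g),
      forall n : int, unitary (Xmod R D n) (Xmod R D (n + 1)) (dil D),
      forall n : int,
        unitary (Xhatmod R D n) (Xhatmod R D (n + 1)) (dil_hat D),
      forall n k : int, isomorphic (Xmod R D n) (Xmod R D k) &
      forall n k : int, isomorphic (Xhatmod R D n) (Xhatmod R D k)].
Proof.
move=> dilD.
have udil n : unitary (Xmod R D n) (Xmod R D (n + 1)) (dil D).
  rewrite dilE; apply: unitary_wcomp; first exact: det_dilation_matrix.
  exact: intertwines_Dmx.
split.
- move=> n g; rewrite translE; apply: unitary_wcomp.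
    by rewrite det1 oner_neq0.
  exact: intertwines1.
- exact: udil.
- exact: unitary_dil_hat.
- by apply: isomorphic_int => n; exists (dil D).
- by apply: isomorphic_int => n; exists (dil_hat D); exact: unitary_dil_hat.
Qed.
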